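(* Let $T$ be an inverse semigroup and let $\mathcal{U}$ be a right inverse $T$-set. Then the semigroup $L(\mathcal{U})$ of all adjointable maps on $\mathcal{U}$ (with composition of maps as multiplication) is an inverse semigroup.
   Context: A semigroup $T$ is inverse if every $t\in T$ has a unique $t^*\in T$ (its generalized inverse) with $tt^*t=t$ and $t^*tt^*=t^*$. A right $T$-set is a set $\mathcal{U}$ with a map $\mathcal{U}\times T\to\mathcal{U}$, $(u,t)\mapsto ut$, such that $(ut)t'=u(tt')$. A right regular $T$-set is a right $T$-set $\mathcal{U}$ with a map $\langle\cdot|\cdot\rangle_{\mathcal{U}}:\mathcal{U}\times\mathcal{U}\to T$ (the right pairing) such that for all $u,u'\in\mathcal{U}$, $t\in T$: (R-i) $\langle u|u't\rangle_{\mathcal{U}}=\langle u|u'\rangle_{\mathcal{U}}t$; (R-ii) $\langle u|u'\rangle_{\mathcal{U}}^*=\langle u'|u\rangle_{\mathcal{U}}$; (R-iii) $u\langle u|u\rangle_{\mathcal{U}}=u$. A right inverse $T$-set is a right regular $T$-set such that moreover (R-iv) $u\langle u'|u\rangle_{\mathcal{U}}=u$ and $u'\langle u|u'\rangle_{\mathcal{U}}=u'$ imply $u=u'$, for all $u,u'\in\mathcal{U}$. A map $\varphi:\mathcal{U}\to\mathcal{U}$ is adjointable if there is a map $\psi:\mathcal{U}\to\mathcal{U}$ (an adjoint of $\varphi$) with $\langle\psi(v)|u\rangle_{\mathcal{U}}=\langle v|\varphi(u)\rangle_{\mathcal{U}}$ for all $u,v\in\mathcal{U}$. $L(\mathcal{U})$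 is the set of adjointable maps $\mathcal{U}\to\mathcal{U}$; it is a semigroup under composition. *)

(* Defs.v *)
From HB Require Import structures.
From mathcomp Require Import all_boot.
From mathcomp Require Import boolp.

Set Implicit Arguments.
Unset Strict Implicit.
Unset Printing Implicit Defensive.

Local Open Scope group_scope.

Definition generalized_inverse (S : semigroupType) (t s : S) : Prop :=
  t * s * t = t /\ s * t * s = s.

Definition inverse_semigroup (S : semigroupType) : Prop :=
  forall t : S, exists! s : S, generalized_inverse t s.

HB.mixin Record Semigroup_isInverse T of Semigroup T := {
  inverse_semigroupP : inverse_semigroup T
}.

#[short(type="inverseSemigroupType")]
HB.structure Definition InverseSemigroup :=
  {T of Semigroup_isInverse T & Semigroup T}.

Definition star (T : inverseSemigroupType) (t : T) : T :=
  sval (cid (inverse_semigroupP t)).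

HB.mixin Record isRightSet (T : semigroupType) U := {
  ract : U -> T -> U;
  ractA : forall u t t', ract (ract u t) t' = ract u (t * t')
}.

#[short(type="rightSetType")]
HB.structure Definition RightSet (T : semigroupType) := {U of isRightSet T U}.

HB.mixin Record RightSet_isRegular (T : inverseSemigroupType) U
    of RightSet T U := {
  pairing : U -> U -> T;
  pairing_ract : forall (u u' : U) (t : T),
    pairing u (ract u' t) = pairing u u' * t;
  star_pairing : forall u u' : U, star (pairing u u') = pairing u' u;
  ract_pairing : forall u : U, ract u (pairing u u) = u
}.

#[short(type="rightRegularSetType")]
HB.structure Definition RightRegularSet (T : inverseSemigroupType) :=
  {U of RightSet T U & RightSet_isRegular T U}.

HB.mixin Record RightRegularSet_isInverse (T : inverseSemigroupType) U
    of RightRegularSet T U := {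
  ract_pairing_inj : forall u u' : U,
    ract u (pairing u' u) = u -> ract u' (pairing u u') = u' -> u = u'
}.

#[short(type="rightInverseSetType")]
HB.structure Definition RightInverseSet (T : inverseSemigroupType) :=
  {U of RightRegularSet T U & RightRegularSet_isInverse T U}.

Section Adjointable.
Context (T : inverseSemigroupType) (U : rightRegularSetType T).

Definition adjoint (phi psi : U -> U) : Prop :=
  forall u v : U, pairing (psi v) u = pairing v (phi u).

Definition adjointable (phi : U -> U) : Prop := exists psi, adjoint phi psi.

Definition adjointable_map : Type := {phi : U -> U | adjointable phi}.

Lemma adjointable_comp (phi psi : U -> U) :
  adjointable phi -> adjointable psi -> adjointable (phi \o psi).
Proof.
move=> [phi' Hphi] [psi' Hpsi]; exists (psi' \o phi') => u v /=.
by rewrite Hpsi Hphi.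
Qed.

Definition adjointable_mul (phi psi : adjointable_map) : adjointable_map :=
  exist adjointable (sval phi \o sval psi)
    (adjointable_comp (svalP phi) (svalP psi)).

Lemma adjointable_mulA : associative adjointable_mul.
Proof. by move=> phi psi chi; apply: eq_exist. Qed.

HB.instance Definition _ := gen_eqMixin adjointable_map.
HB.instance Definition _ := gen_choiceMixin adjointable_map.
HB.instance Definition _ := isSemigroup.Build adjointable_map adjointable_mulA.

End Adjointable.

(* Main.v *)
Require Import Defs.
From mathcomp Require Import all_boot.
From mathcomp Require Import boolp.

(** The argument rests on the criterion that a semigroup is inverse as soon as
    it is regular and its idempotents commute ([inverse_semigroup_criterion]).

    Write [p = <phi u|phi u>] for an adjointable [phi] with adjoint [psi]; it is
    an idempotent of [T].  The separation axiom (R-iv) forces [psi (phi u)] to be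
    [u p] ([adjoint_compE]): the composite [psi phi] moves each point of [U] by an
    idempotent of [T] only.  Two facts follow.  First,
    [phi (psi (phi u)) = phi (u p) = (phi u) p = phi u], so [psi] is a
    generalized inverse of [phi] and [L(U)] is regular.  Second, composites of
    this form commute with each other, because the idempotents of [T] do.

    An arbitrary adjointable idempotent [f] with adjoint [g] satisfies
    [g = g f g = (g f) (f g)], a product of two such commuting composites; hence
    [g] is self-adjoint, [f = g], and [f = g f] is itself of the form above.
    So all idempotents of [L(U)] commute. *)

Set Implicit Arguments.
Unset Strict Implicit.
Unset Printing Implicit Defensive.

Local Open Scope group_scope.

(** * Inverse semigroups and commuting idempotents *)

Lemma generalized_inverse_sym (S : semigroupType) (t s : S) :
  generalized_inverse t s -> generalized_inverse s t.
Proof. by case. Qed.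

(** Two inverses [s], [s'] of [t] are both equal to [s' t s]: commuting the
    idempotents [s t] and [s' t] gives [s = s' t s], and commuting [t s] and
    [t s'] gives [s' t s = s']. *)
Lemma inverse_semigroup_criterion (S : semigroupType) :
  (forall t : S, exists s, generalized_inverse t s) ->
  (forall e f : S, e * e = e -> f * f = f -> e * f = f * e) ->
  inverse_semigroup S.
Proof.
move=> regS commS t; have [s [tst sts]] := regS t.
exists s; split=> // s' [ts't s'ts'].
have st_comm : (s * t) * (s' * t) = (s' * t) * (s * t).
  by apply: commS; rewrite mulgA ?sts ?s'ts'.
have ts_comm : (t * s) * (t * s') = (t * s') * (t * s).
  by apply: commS; rewrite mulgA ?tst ?ts't.
transitivity (s' * t * s).
  by rewrite -{1}sts -{1}ts't !mulgA -(mulgA (s * t) s' t) st_comm -!mulgA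
             (mulgA s t s) sts.
transitivity (s' * ((t * s') * (t * s))); first by rewrite !mulgA s'ts'.
transitivity (s' * (t * s * t) * s'); first by rewrite -ts_comm !mulgA.
by rewrite tst s'ts'.
Qed.

Section InverseSemigroup.
Context (T : inverseSemigroupType).
Implicit Types t s e f : T.

Lemma starP t : generalized_inverse t (star t).
Proof. by rewrite /star; case: cid => s /= []. Qed.

Lemma generalized_inverse_uniq t s s' :
  generalized_inverse t s -> generalized_inverse t s' -> s = s'.
Proof.
by move=> ts ts'; have [r [_ uniq_r]] := inverse_semigroupP t;
  rewrite -(uniq_r _ ts) (uniq_r _ ts').
Qed.

(** If [x] is the inverse of [e f], then so is [f x e], which is idempotent; thus
    [x] is idempotent, hence its own inverse, and [e f = x]. *)
Lemma idempotent_mul e f :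
  e * e = e -> f * f = f -> e * f * (e * f) = e * f.
Proof.
move=> ee ff; set x := star (e * f).
have [efx xef] := starP (e * f); rewrite -/x in efx xef.
have fxeP : generalized_inverse (e * f) (f * x * e).
  split.
  - rewrite -[RHS]efx !mulgA -(mulgA e f f) ff.
    by rewrite -(mulgA (e * f * x)) ee.
  - rewrite -[in RHS]xef !mulgA -(mulgA _ e e) ee.
    by rewrite -(mulgA _ f f) ff.
have xE : f * x * e = x by apply: generalized_inverse_uniq fxeP (starP _).
have xx : x * x = x.
  rewrite -[in LHS]xE !mulgA -(mulgA (f * x * e)) -[in RHS]xE -[in RHS]xef.
  by rewrite !mulgA.
suff -> : e * f = x by [].
apply: (@generalized_inverse_uniq x); last by split; rewrite !xx.
exact: generalized_inverse_sym (starP _).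
Qed.

(** Both [e f] and [f e] are inverses of [e f]. *)
Lemma idempotent_comm e f : e * e = e -> f * f = f -> e * f = f * e.
Proof.
move=> ee ff; have efef := idempotent_mul ee ff.
have fefe := idempotent_mul ff ee.
apply: (@generalized_inverse_uniq (e * f)); first by split; rewrite !efef.
by split; [rewrite -[RHS]efef | rewrite -[RHS]fefe];
  rewrite !mulgA -(mulgA _ f f) ff -(mulgA _ e e) ee.
Qed.

Lemma starM t s : star (t * s) = star s * star t.
Proof.
have [tt' t't] := starP t; have [ss' s's] := starP s.
(* The idempotents t^* t and s s^* meet in the middle of each product. *)
have comm : (star t * t) * (s * star s) = (s * star s) * (star t * t).
  by apply: idempotent_comm; rewrite mulgA ?t't ?ss'.
apply: generalized_inverse_uniq (starP _) _; split.
- transitivity (t * ((s * star s) * (star t * t)) * s); first by rewrite !mulgA.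
  by rewrite -comm !mulgA tt' -!mulgA (mulgA s) ss'.
- transitivity (star s * ((star t * t) * (s * star s)) * star t).
    by rewrite !mulgA.
  by rewrite comm !mulgA s's -!mulgA (mulgA (star t)) t't.
Qed.

End InverseSemigroup.

(** * Pairings in a right inverse set *)

Section RightInverseSet.
Context (T : inverseSemigroupType) (U : rightInverseSetType T).
Implicit Types u v x y : U.

Lemma pairing_ractl u v (t : T) : pairing (ract u t) v = star t * pairing u v.
Proof. by rewrite -star_pairing pairing_ract starM star_pairing. Qed.

Lemma pairing_self_idem u : pairing u u * pairing u u = pairing u u.
Proof. by rewrite -pairing_ract ract_pairing. Qed.

(** The form in which the separation axiom (R-iv) is used; since [<x|x>] is fixed
    by the involution, only one of [<x|y>], [<y|x>] needs to be known. *)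
Lemma eq_from_pairing x y :
  pairing x y = pairing x x -> pairing x y = pairing y y -> x = y.
Proof.
move=> xyx xyy; apply: (@ract_pairing_inj T U).
- by rewrite -star_pairing xyx star_pairing ract_pairing.
- by rewrite xyy ract_pairing.
Qed.

Lemma pairing_nondegenerate x y :
  (forall v, pairing v x = pairing v y) -> x = y.
Proof.
move=> xy; apply: eq_from_pairing; first by rewrite xy.
by rewrite -star_pairing xy star_pairing.
Qed.

(** With [a = <u|v>], both sides have all their mutual pairings equal to
    [a^* a].  In [U = T] with [<s|t> = s^* t] this is the identity
    [u u^* v = v (v^* u u^* v)], an instance of commuting idempotents. *)
Lemma ract_pairing_swap u v :
  ract u (pairing u v) = ract v (pairing v u * pairing u v).
Proof.
have uuv : pairing u u * pairing u v = pairing u v.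
  by rewrite -[in RHS](ract_pairing u) pairing_ractl star_pairing.
have uvv : pairing u v * pairing v v = pairing u v.
  by rewrite -pairing_ract ract_pairing.
have [_ vuv] := starP (pairing u v); rewrite star_pairing in vuv.
by apply: eq_from_pairing;
  rewrite !(pairing_ract, pairing_ractl, starM, star_pairing) !mulgA ?vuv //;
  rewrite -?(mulgA _ _ (pairing u v)) ?uuv // -(mulgA _ (pairing u v)) uvv
          !mulgA vuv.
Qed.

(** * Adjointable maps *)

Implicit Types phi psi f g : U -> U.

Lemma adjoint_sym phi psi : adjoint phi psi -> adjoint psi phi.
Proof. by move=> adj u v; rewrite -star_pairing -adj star_pairing. Qed.

Lemma adjoint_uniq phi psi psi' :
  adjoint phi psi -> adjoint phi psi' -> psi =1 psi'.
Proof.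
move=> adj adj' v; apply: pairing_nondegenerate => u.
by rewrite -(adjoint_sym adj) (adjoint_sym adj').
Qed.

Lemma adjointable_ract phi u (t : T) :
  adjointable phi -> phi (ract u t) = ract (phi u) t.
Proof.
case=> psi adj; apply: pairing_nondegenerate => v.
by rewrite -adj !pairing_ract adj.
Qed.

(** Put [p = <phi u|phi u>], which equals [<psi (phi u)|u>].  Moving
    [psi (phi u)] by [p] changes nothing, since [phi u] absorbs [p], and the
    swapping identity for the pair [psi (phi u)], [u] turns the result into
    [u p]. *)
Lemma adjoint_compE phi psi u :
  adjoint phi psi -> psi (phi u) = ract u (pairing (phi u) (phi u)).
Proof.
move=> adj; have := ract_pairing_swap (psi (phi u)) u.
rewrite -[pairing u _]star_pairing adj star_pairing pairing_self_idem => <-.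
by rewrite -adjointable_ract ?ract_pairing //; exists phi; apply: adjoint_sym.
Qed.

Lemma adjoint_regular phi psi u : adjoint phi psi -> phi (psi (phi u)) = phi u.
Proof.
move=> adj.
by rewrite (adjoint_compE _ adj) adjointable_ract ?ract_pairing //; exists psi.
Qed.

(** On a point [u] the two sides are [u] moved by the same two idempotents of
    [T], in either order. *)
Lemma adjoint_comp_comm phi psi phi' psi' u :
  adjoint phi psi -> adjoint phi' psi' ->
  psi (phi (psi' (phi' u))) = psi' (phi' (psi (phi u))).
Proof.
move=> adj adj'.
have aphi : adjointable phi by exists psi.
have apsi : adjointable psi by exists phi; apply: adjoint_sym.
have aphi' : adjointable phi' by exists psi'.
have apsi' : adjointable psi' by exists phi'; apply: adjoint_sym.
rewrite [psi' (phi' u)](adjoint_compE _ adj') !adjointable_ract //.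
rewrite [psi (phi u)](adjoint_compE _ adj) !adjointable_ract //.
rewrite [psi' (phi' u)](adjoint_compE _ adj') !ractA.
by rewrite (idempotent_comm (pairing_self_idem _) (pairing_self_idem _)).
Qed.

(** Since [g = g f g = (g f) (f g)] is a product of two commuting self-adjoint
    maps, it is self-adjoint. *)
Lemma idempotent_adjointE f g : adjoint f g -> f \o f =1 f -> g =1 f.
Proof.
move=> fg ff; have gf := adjoint_sym fg.
have gE v : g v = g (f (f (g v))).
  by have /= -> := ff (g v); rewrite (adjoint_regular v gf).
have gE' v : g v = f (g (g (f v))).
  by rewrite gE (adjoint_comp_comm v fg gf).
have gg : adjoint g g.
  by move=> u v; rewrite [in RHS]gE -gf -fg -fg -gf -gE'.
exact: adjoint_uniq gg gf.
Qed.

Lemma idempotent_adjointable_comm f g :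
  adjointable f -> adjointable g -> f \o f =1 f -> g \o g =1 g ->
  f \o g =1 g \o f.
Proof.
move=> [f' ff'] [g' gg'] fid gid u.
have := adjoint_comp_comm u ff' gg'.
rewrite !(idempotent_adjointE ff' fid) !(idempotent_adjointE gg' gid).
have fK x : f (f x) = f x := fid x; have gK x : g (g x) = g x := gid x.
by rewrite !fK !gK.
Qed.

End RightInverseSet.

Lemma adjointable_map_eqP (T : inverseSemigroupType) (U : rightInverseSetType T)
    (phi psi : adjointable_map U) :
  phi = psi <-> sval phi =1 sval psi.
Proof.
split=> [-> // | ]; case: phi => phi aphi; case: psi => psi apsi /= /funext eq.
exact: eq_exist.
Qed.

Theorem theorem3p30 (T : inverseSemigroupType) (U : rightInverseSetType T) :
  inverse_semigroup (adjointable_map U).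
Proof.
apply: inverse_semigroup_criterion => [[phi [psi adj]] | e f].
- have adj' := adjoint_sym adj.
  exists (exist _ psi (ex_intro _ phi adj')).
  split; apply/adjointable_map_eqP => u /=.
  + exact: (adjoint_regular u adj).
  + exact: (adjoint_regular u adj').
- move=> /adjointable_map_eqP ee /adjointable_map_eqP ff.
  apply/adjointable_map_eqP.
  exact: idempotent_adjointable_comm (svalP e) (svalP f) ee ff.
Qed.
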